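(* Let $(V,g)$ be a Euclidean real vector space of dimension $n$ and let $R$ be a symmetric $(2,2)$ double form on $V$ satisfying the first Bianchi identity. Let $\mathrm c$ denote the contraction map, and put $$h_{2k}(R)=*\frac{g^{n-2k}R^k}{(n-2k)!},\qquad T_{2k}(R)=*\frac{g^{n-2k-1}R^k}{(n-2k-1)!},\qquad N_{2k}(R)=*\frac{g^{n-2k-2}R^k}{(n-2k-2)!}.$$ Then $$\mathrm c\,N_{2k}(R)=(n-2k-1)\,T_{2k}(R)\quad(2\le 2k\le n-2),\qquad \mathrm c\,T_{2k}(R)=(n-2k)\,h_{2k}(R)\quad(2\le 2k\le n-1).$$
   Context: Let $(V,g)$ be a Euclidean real vector space of dimension $n$. A $(p,q)$ double form is an element of $\mathcal D^{p,q}=\Lambda^pV^*\otimes\Lambda^qV^*$, identified with a bilinear form $\Lambda^pV\times\Lambda^qV\to\mathbb R$. Exterior product: $(\theta_1\otimes\theta_2)(\theta_3\otimes\theta_4)=(\theta_1\wedge\theta_3)\otimes(\theta_2\wedge\theta_4)$, extended bilinearly; products and powers in the claim are exterior products, with zeroth power $1$; $g$ is regarded as a $(1,1)$ double form. Contraction $\mathrm c:\mathcal D^{p,q}\to\mathcal D^{p-1,q-1}$: $\mathrm c\,\omega(x_1\wedge\dots\wedge x_{p-1},y_1\wedge\dots\wedge y_{q-1})=\sum_{j=1}^n\omega(e_j\wedge x_1\wedge\dots\wedge x_{p-1},e_j\wedge y_1\wedge\dots\wedge y_{q-1})$ for any orthonormal basis $(e_j)$. Double Hodge star: for a $(p,p)$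 double form $\omega$, $*\omega$ is the $(n-p,n-p)$ double form $*\omega(u,v)=\omega( *u,*v)$, with $*$ on the right the usual Hodge star $\Lambda^{n-p}V\to\Lambda^{p}V$ for some chosen orientation (the result does not depend on it). A $(0,0)$ double form is a scalar. A $(2,2)$ double form $R$ is symmetric if $R(u,v)=R(v,u)$ for $u,v\in\Lambda^2V$, and satisfies the first Bianchi identity if $\sum_{j=1}^{3}(-1)^jR(x_1\wedge\dots\widehat{x_j}\dots\wedge x_3,\;x_j\wedge y)=0$ for all $x_1,x_2,x_3,y\in V$. *)

(* Defs.v *)
From HB Require Import structures.
From mathcomp Require Import all_boot all_order all_algebra.
From mathcomp Require Import reals.

Set Implicit Arguments.
Unset Strict Implicit.
Unset Printing Implicit Defensive.

Import Order.TTheory GRing.Theory Num.Theory.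
Local Open Scope ring_scope.

Section DoubleForms.
Variables (R : realType) (V : vectType R).

(* The list [:: x_1; ...; x_p] stands for the decomposable multivector
   x_1 /\ ... /\ x_p.  By the universal property of the exterior power, a linear
   form on /\^p V is an alternating multilinear function of p vectors. *)
Definition form := seq V -> R.

Definition multilinear (t : form) : Prop :=
  forall (s1 s2 : seq V) (a : R) (u v : V),
    t (s1 ++ (a *: u + v) :: s2) = a * t (s1 ++ u :: s2) + t (s1 ++ v :: s2).

Definition alternating (t : form) : Prop :=
  forall (s1 s2 s3 : seq V) (u : V), t (s1 ++ u :: s2 ++ u :: s3) = 0.

(* The functions [seq V -> seq V -> R] carry all bidegrees at once: a (p, q)
   double form is extended by 0 to lists of other lengths, so the sum of the
   D^{p,q} lives in a single type and degrees need no casts. *)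
Definition dform := seq V -> seq V -> R.

Record is_dform (p q : nat) (w : dform) : Prop := IsDform {
  dform_degree : forall x y, (size x != p) || (size y != q) -> w x y = 0;
  dform_multl : forall y, multilinear (w ^~ y);
  dform_multr : forall x, multilinear (w x);
  dform_altl : forall y, alternating (w ^~ y);
  dform_altr : forall x, alternating (w x)
}.

(* A general multivector, as a linear combination of decomposable ones. *)
Definition mvector := seq (R * seq V).

(* Bilinear extension of w to linear combinations. *)
Definition deval (w : dform) (u v : mvector) : R :=
  \sum_(a <- u) \sum_(b <- v) a.1 * b.1 * w a.2 b.2.

Definition dsymmetric (w : dform) : Prop :=
  forall u v : mvector, deval w u v = deval w v u.

(* The index j of the usual formula runs from 1 to 3, here from 0 to 2. *)
Definition bianchi (w : dform) : Prop :=
  forall (x : 3.-tuple V) (y : V),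
    \sum_(j < 3) (-1) ^+ j.+1 * w (take j x ++ drop j.+1 x) [:: tnth x j; y]
    = 0.

(* A mask m splits a list into [mask m x] followed by [mask (map negb m) x];
   [msign m] is the signature of the corresponding unshuffle. *)
Fixpoint inversions (m : bitseq) : nat :=
  if m is b :: m' then
    ((if b then 0 else count id m') + inversions m')%N
  else 0%N.

Definition msign (m : bitseq) : R := (-1) ^+ inversions m.

Definition wedge (t1 t2 : form) : form := fun x =>
  \sum_(m : (size x).-tuple bool)
    msign m * (t1 (mask m x) * t2 (mask (map negb m) x)).

Definition tens (t1 t2 : form) : dform := fun x y => t1 x * t2 y.

Definition dmul (w1 w2 : dform) : dform := fun x y =>
  \sum_(a : (size x).-tuple bool) \sum_(b : (size y).-tuple bool)
    msign a * msign b *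
    (w1 (mask a x) (mask b y) * w2 (mask (map negb a) x) (mask (map negb b) y)).

(* The defining property of the exterior product of double forms. *)
Lemma dmul_tens (t1 t2 t3 t4 : form) (x y : seq V) :
  dmul (tens t1 t2) (tens t3 t4) x y = tens (wedge t1 t3) (wedge t2 t4) x y.
Proof.
rewrite /tens /wedge mulr_suml; apply: eq_bigr => a _.
rewrite mulr_sumr; apply: eq_bigr => b _.
by rewrite [RHS]mulrACA; congr (_ * _); rewrite mulrACA.
Qed.

Definition done1 : dform := fun x y => (nilp x && nilp y)%:R.

Definition dexp (w : dform) (k : nat) : dform := iter k (dmul w) done1.

Definition dscale (a : R) (w : dform) : dform := fun x y => a * w x y.

Section Euclidean.
Variable g : {dot V for idfun}.

Definition dmetric : dform := fun x y =>
  match x, y with [:: u], [:: v] => g u v | _, _ => 0 end.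

Definition orthonormal_basis (e : seq V) : Prop :=
  orthonormal g e /\ basis_of {:V} e.

Definition contraction (e : seq V) (w : dform) : dform := fun x y =>
  \sum_(u <- e) w (u :: x) (u :: y).

Section Hodge.
(* f is an orthonormal basis, which also fixes the orientation. *)
Variables (n : nat) (f : n.-tuple V).

Definition vol (x : seq V) : R :=
  if size x == n then \det (\matrix_(i < n, j < n) g (tnth f i) (nth 0 x j))
  else 0.

(* The multivector f_I = f_{i_1} /\ ... /\ f_{i_p}, with i_1 < ... < i_p the
   elements of I. *)
Definition fsub (I : {set 'I_n}) : seq V := [seq tnth f i | i <- enum I].

(* The usual Hodge star is given by <*u, w> vol = u /\ w for every w of
   complementary degree.  In the orthonormal basis (f_I) of /\ V, this reads
   *(x_1 /\ ... /\ x_q) = sum_{#|I| = n - q} vol(x_1, ..., x_q, f_I) f_I. *)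
Definition hodge (x : seq V) : mvector :=
  [seq (vol (x ++ fsub J), fsub J)
     | J <- enum [set J : {set 'I_n} | (size x + #|J| == n)%N]].

Definition dstar (w : dform) : dform := fun x y =>
  deval w (hodge x) (hodge y).

(* Inner product of two decomposable multivectors of the same degree. *)
Definition gram (x y : seq V) : R :=
  \det (\matrix_(i < size y, j < size y) g (nth 0 x i) (nth 0 y j)).

Lemma gram_fsub (I K : {set 'I_n}) : orthonormal_basis f -> #|I| = #|K| ->
  gram (fsub I) (fsub K) = (I == K)%:R.
Proof.
move=> [of_ bf] cIK.
have gf i j : g (tnth f i) (tnth f j) = (i == j)%:R.
  have fu : uniq f by apply: free_uniq; apply: basis_free bf.
  have := of_; rewrite orthonormalE /pairwise_orthogonal => /and3P[f1 _ f2].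
  have [<-|nij] := eqVneq i j.
    by apply/eqP; apply: (allP f1); apply: mem_tnth.
  have key (s : seq V) : pair_ortho_rec g s -> forall u v,
      u \in s -> v \in s -> u != v -> g u v = 0.
    elim: s => //= w s IH /andP[/andP[ws _] os] u v.
    rewrite !inE => /orP[/eqP->|us] /orP[/eqP->|vs] //.
    - by rewrite eqxx.
    - by move=> _; apply/eqP; apply: (allP ws).
    - by move=> _; rewrite hermC expr0 mul1r; apply/eqP; apply: (allP ws).
    - exact: IH.
  apply: (key f f2); rewrite ?mem_tnth //.
  by rewrite !(tnth_nth 0) nth_uniq ?size_tuple.
have sz (J : {set 'I_n}) : size (fsub J) = #|J| by rewrite size_map -cardE.
have [->|nIK] := eqVneq I K.
  rewrite /gram (_ : \matrix_(i, j) _ = 1%:M) ?det1 //.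
  apply/matrixP => i j; rewrite !mxE.
  have [li lj] : (i < size (enum K) /\ j < size (enum K))%N.
    by split; rewrite -cardE -sz ltn_ord.
  have i0 : 'I_n by move: li; case: (enum K).
  by rewrite !(nth_map i0) // gf nth_uniq ?enum_uniq.
have /subsetPn[k kK kI] : ~~ (K \subset I).
  by apply: contra nIK => sKI; rewrite eq_sym eqEcard sKI cIK leqnn.
have lk : (index k (enum K) < size (fsub K))%N.
  by rewrite sz cardE index_mem mem_enum.
rewrite /gram -det_tr (expand_det_row _ (Ordinal lk)) big1 // => j _.
have lj : (j < size (enum I))%N by rewrite -cardE cIK -sz.
rewrite !mxE /= !(nth_map k) ?index_mem ?mem_enum // nth_index ?mem_enum //.
rewrite gf; case: eqP => [E|]; last by rewrite mul0r.
by case/negP: kI; move: (mem_nth k lj); rewrite E mem_enum.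
Qed.

(* The defining property <*u, w> vol = u /\ w, for w = f_K. *)
Lemma hodge_fsub (x : seq V) (K : {set 'I_n}) :
  orthonormal_basis f -> (size x + #|K| = n)%N ->
  \sum_(b <- hodge x) b.1 * gram b.2 (fsub K) = vol (x ++ fsub K).
Proof.
move=> of_ xK; rewrite big_map big_enum /= (bigD1 K) /=; last by rewrite inE xK.
rewrite gram_fsub // eqxx mulr1 big1 ?addr0 // => I.
rewrite inE -[X in _ == X]xK eqn_add2l => /andP[/eqP cI /negPf nI].
by rewrite gram_fsub // nI mulr0.
Qed.

Variable (Rm : dform) (k : nat).

Definition h2k : dform :=
  dstar (dscale ((n - 2 * k)`!)%:R^-1
    (dmul (dexp dmetric (n - 2 * k)) (dexp Rm k))).

Definition T2k : dform :=
  dstar (dscale ((n - 2 * k - 1)`!)%:R^-1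
    (dmul (dexp dmetric (n - 2 * k - 1)) (dexp Rm k))).

Definition N2k : dform :=
  dstar (dscale ((n - 2 * k - 2)`!)%:R^-1
    (dmul (dexp dmetric (n - 2 * k - 2)) (dexp Rm k))).

End Hodge.
End Euclidean.
End DoubleForms.

(* Main.v *)
(* Contraction is the Hodge dual of multiplication by the metric:
   c (star w) = star (g w) for every w living in the bidegrees (p, p).  Expanding both
   sides in an orthonormal basis f, the left side contains the factors
   vol(f_t, x, f_J) vol(f_t, y, f_K) summed over t, and the right side the
   factors vol(x, f_J') vol(y, f_K') together with the unshuffle signs that
   extract a common index t from J' = J + t and K' = K + t; moving f_t to the
   front identifies the two.  Taking w = g^m R^k / m!, the product g w is
   (m + 1) g^(m+1) R^k / (m + 1)! by associativity.  *)
Require Import Defs.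
From mathcomp Require Import all_boot all_order all_algebra.
From mathcomp Require Import reals zify.

Set Implicit Arguments.
Unset Strict Implicit.
Unset Printing Implicit Defensive.

Import Order.TTheory GRing.Theory Num.Theory.
Local Open Scope ring_scope.

(** * Unshuffle sums and their coassociativity *)

Lemma big_tuple_cons (R : Type) (idx : R) (op : Monoid.com_law idx)
    (I : finType) n (F : n.+1.-tuple I -> R) :
  \big[op/idx]_t F t =
  \big[op/idx]_(i : I) \big[op/idx]_(t : n.-tuple I) F [tuple of i :: t].
Proof.
rewrite pair_big /=.
rewrite (reindex (fun p : I * n.-tuple I => [tuple of p.1 :: p.2])) //=.
exists (fun t : n.+1.-tuple I => (thead t, [tuple of behead t])) => [[i t] _|t _].
  by congr (_, _); apply: val_inj.
by rewrite [RHS]tuple_eta.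
Qed.

Section Unshuffle.
Variables (R : realType) (T : Type).

(* The sum of [F x' x''] over all splittings of [x] into complementary
   subsequences, weighted by the signature of the unshuffle: the coproduct of
   the exterior algebra. *)
Definition unshuffle (F : seq T -> seq T -> R) (x : seq T) : R :=
  \sum_(a : (size x).-tuple bool)
    msign R a * F (mask a x) (mask (map negb a) x).

Lemma eq_unshuffle (F G : seq T -> seq T -> R) x :
  (forall u v, (size u + size v = size x)%N -> F u v = G u v) ->
  unshuffle F x = unshuffle G x.
Proof.
move=> eqFG; apply: eq_bigr => a _; rewrite eqFG //.
rewrite !size_mask ?size_map ?size_tuple //.
by rewrite count_map -[RHS](size_tuple a) -(count_predC id).
Qed.

Lemma unshuffle_nil F : unshuffle F [::] = F [::] [::].
Proof.
rewrite /unshuffle (big_pred1 [tuple]) => [|a]; first by rewrite mul1r.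
by apply/esym/eqP; apply: tuple0.
Qed.

(** The head joins the first part at no cost, or joins the second and then passes every element of
    the first, whence the sign. *)
Lemma unshuffle_cons F h x :
  unshuffle F (h :: x) =
  unshuffle (fun u v => F (h :: u) v) x +
  unshuffle (fun u v => (-1) ^+ size u * F u (h :: v)) x.
Proof.
rewrite /unshuffle big_tuple_cons big_bool /=; congr (_ + _).
apply: eq_bigr => a _; rewrite size_mask ?size_tuple // mulrA.
by rewrite /msign /= exprD [_ ^+ count _ _ * _]mulrC.
Qed.

Lemma unshuffleD F G x :
  unshuffle (fun u v => F u v + G u v) x = unshuffle F x + unshuffle G x.
Proof. by rewrite -big_split; apply: eq_bigr => a _; rewrite mulrDr. Qed.

Lemma unshuffleZ (c : R) F x :
  unshuffle (fun u v => c * F u v) x = c * unshuffle F x.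
Proof. by rewrite /unshuffle mulr_sumr; apply: eq_bigr => a _; rewrite mulrCA. Qed.

Lemma unshuffle0 x : unshuffle (fun _ _ => 0) x = 0.
Proof. by rewrite /unshuffle big1 // => a _; rewrite mulr0. Qed.

Lemma unshuffle_sum (I : finType) (F : I -> seq T -> seq T -> R) x :
  unshuffle (fun u v => \sum_i F i u v) x = \sum_i unshuffle (F i) x.
Proof.
by rewrite exchange_big; apply: eq_bigr => a _; rewrite mulr_sumr.
Qed.

(** Both sides sum over splittings of [x] into three parts. By induction, it suffices to compare the
    three places where the head can go. *)
Lemma unshuffleA (F : seq T -> seq T -> seq T -> R) x :
  unshuffle (fun u x3 => unshuffle (fun x1 x2 => F x1 x2 x3) u) x =
  unshuffle (fun x1 v => unshuffle (fun x2 x3 => F x1 x2 x3) v) x.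
Proof.
elim: x F => [|h x IH] F; first by rewrite !unshuffle_nil.
rewrite !unshuffle_cons.
under [X in X + _ = _]eq_unshuffle => u v _ do rewrite unshuffle_cons.
under [X in _ = _ + X]eq_unshuffle => u v _ do
  rewrite unshuffle_cons mulrDr -!unshuffleZ.
rewrite !unshuffleD -addrA IH; congr (_ + _).
rewrite IH; congr (_ + _).
under eq_unshuffle => u v _.
  rewrite -unshuffleZ.
  (* Since [u] splits into [x1] and [x2], the sign for passing [u] is the product of the signs for
     passing each. *)
  under eq_unshuffle => x1 x2 e do rewrite -e exprD -mulrA.
  over.
exact: IH.
Qed.

End Unshuffle.

Lemma exchange_unshuffle (R : realType) (T : Type)
    (F : seq T -> seq T -> seq T -> seq T -> R) x y :
  unshuffle (fun x1 x2 => unshuffle (fun y1 y2 => F x1 x2 y1 y2) y) x =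
  unshuffle (fun y1 y2 => unshuffle (fun x1 x2 => F x1 x2 y1 y2) x) y.
Proof.
rewrite /unshuffle; under eq_bigr do rewrite mulr_sumr.
rewrite exchange_big /=; apply: eq_bigr => b _; rewrite mulr_sumr.
by apply: eq_bigr => a _; rewrite mulrCA.
Qed.

Lemma unshuffle_size0 (R : realType) (T : Type) (F : seq T -> seq T -> R) x :
  (forall u v, size u != 0%N -> F u v = 0) -> unshuffle F x = F [::] x.
Proof.
elim: x F => [|h x IH] F F0; first by rewrite unshuffle_nil.
rewrite unshuffle_cons [X in _ + X]IH => [|u v u0]; last by rewrite F0 // mulr0.
rewrite mul1r (_ : unshuffle _ x = 0) ?add0r //.
by rewrite -(unshuffle0 R x); apply: eq_unshuffle => u v _; rewrite F0.
Qed.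

(** Only splittings that extract a single element survive; bringing it to the front costs one
    transposition per predecessor. Uniqueness in [s] lets [index] and [rem] name the position, even
    after mapping by [h]. *)
Lemma unshuffle_size1 (R : realType) (T : eqType) (W : Type) (h : T -> W)
    (F : seq W -> seq W -> R) (s : seq T) :
  uniq s -> (forall u v, size u != 1%N -> F u v = 0) ->
  unshuffle F (map h s) =
  \sum_(t <- s) (-1) ^+ index t s * F [:: h t] (map h (rem t s)).
Proof.
elim: s F => [|a s IH] F /=; first by rewrite unshuffle_nil big_nil => _ ->.
move=> /andP[aNs us] F1; rewrite unshuffle_cons big_cons eqxx mul1r.
rewrite unshuffle_size0 => [|u v u0]; last exact: F1.
rewrite IH // => [|u v u1]; last by rewrite F1 ?mulr0.
congr (_ + _); apply: eq_big_seq => t ts.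
have /negPf-> : a != t by apply: contraNneq aNs => ->.
by rewrite mulrA -exprD addn1.
Qed.

(** * The exterior product of double forms *)

Section DoubleFormAlgebra.
Variables (R : realType) (V : vectType R).
Implicit Types w : dform V.

Lemma dmulE w1 w2 x y :
  dmul w1 w2 x y =
  unshuffle (fun x1 x2 => unshuffle (fun y1 y2 => w1 x1 y1 * w2 x2 y2) y) x.
Proof.
apply: eq_bigr => a _; rewrite mulr_sumr; apply: eq_bigr => b _.
by rewrite -mulrA.
Qed.

(** Coassociativity of the unshuffle is applied in each of the two arguments; the sums over [x] and
    over [y] commute. *)
Lemma dmulA w1 w2 w3 x y :
  dmul w1 (dmul w2 w3) x y = dmul (dmul w1 w2) w3 x y.
Proof.
pose F x1 x2 x3 y1 y2 y3 := w1 x1 y1 * w2 x2 y2 * w3 x3 y3.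
transitivity (unshuffle (fun x1 u => unshuffle (fun x2 x3 =>
  unshuffle (fun y1 v => unshuffle (F x1 x2 x3 y1) v) y) u) x).
  rewrite dmulE; apply: eq_unshuffle => x1 u _.
  rewrite -exchange_unshuffle; apply: eq_unshuffle => y1 v _.
  rewrite dmulE -unshuffleZ; apply: eq_unshuffle => x2 x3 _.
  by rewrite -unshuffleZ; apply: eq_unshuffle => y2 y3 _; rewrite mulrA.
rewrite -unshuffleA dmulE; apply: eq_unshuffle => u x3 _.
transitivity (unshuffle (fun x1 x2 => unshuffle (fun v y3 =>
    unshuffle (fun y1 y2 => F x1 x2 x3 y1 y2 y3) v) y) u).
  by apply: eq_unshuffle => x1 x2 _; rewrite -unshuffleA.
rewrite exchange_unshuffle; apply: eq_unshuffle => v y3 _.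
rewrite dmulE mulrC -unshuffleZ; apply: eq_unshuffle => x1 x2 _.
by rewrite -unshuffleZ; apply: eq_unshuffle => y1 y2 _; rewrite mulrC.
Qed.

(** The degree condition for the sum of all bidegrees (p, p): it is stable under products and makes
    the Hodge signs of the two arguments cancel. *)
Definition balanced w := forall x y, size x != size y -> w x y = 0.

Lemma dmul_balanced w1 w2 : balanced w1 -> balanced w2 ->
  balanced (dmul w1 w2).
Proof.
move=> b1 b2 x y nxy; rewrite dmulE -(unshuffle0 R x).
apply: eq_unshuffle => x1 x2 ex; rewrite -(unshuffle0 R y).
apply: eq_unshuffle => y1 y2 ey.
have [e1|/b1->] := eqVneq (size x1) (size y1); last by rewrite mul0r.
have [e2|/b2->] := eqVneq (size x2) (size y2); last by rewrite mulr0.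
by rewrite -ex -ey e1 e2 eqxx in nxy.
Qed.

Lemma dexp_balanced w k : balanced w -> balanced (dexp w k).
Proof.
move=> bw; elim: k => [|k IH]; last exact: dmul_balanced.
by move=> [|? ?] [|? ?].
Qed.

Lemma dform_balanced p w : is_dform p p w -> balanced w.
Proof.
move=> dw x y nxy; apply: (dform_degree dw); rewrite -negb_and.
by apply: contra nxy => /andP[/eqP-> /eqP->].
Qed.

Lemma dmetric_balanced (g : {dot V for idfun}) : balanced (dmetric g).
Proof. by move=> [|? [|? ?]] [|? [|? ?]]. Qed.

End DoubleFormAlgebra.

(** * Orthonormal bases and the volume form *)

Section Star.
Variables (R : realType) (V : vectType R) (g : {dot V for idfun}).

Lemma orthonormal_tnth n (f : n.-tuple V) i j : orthonormal_basis g f ->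
  g (tnth f i) (tnth f j) = (i == j)%:R.
Proof.
move=> of_; have := gram_fsub (I := [set i]) (K := [set j]) of_.
rewrite !cards1 => /(_ erefl).
rewrite /gram /fsub !enum_set1 /= det_mx11 mxE /= => ->.
by rewrite (inj_eq set1_inj).
Qed.

Lemma orthonormal_parseval n (e : n.-tuple V) u v : orthonormal_basis g e ->
  \sum_(i < n) g u (tnth e i) * g v (tnth e i) = g u v.
Proof.
move=> oe; have [_ be] := oe.
have coordE w i : g w (tnth e i) = coord e i w.
  rewrite {1}(coord_basis be (memvf w)) linear_sumlz (bigD1 i) //=.
  rewrite linearZl_LR /= -tnth_nth orthonormal_tnth // eqxx mulr1 big1 ?addr0 //.
  move=> j /negPf ji.
  by rewrite linearZl_LR /= -tnth_nth orthonormal_tnth // ji mulr0.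
rewrite [in RHS](coord_basis be (memvf v)) linear_sumr /=.
by apply: eq_bigr => i _; rewrite linearZr_LR /= -tnth_nth -!coordE mulrC.
Qed.

Variables (n : nat) (f : n.-tuple V).
Local Notation vol := (vol g f).
Local Notation fsub := (fsub f).

Lemma vol_size x : size x != n -> vol x = 0.
Proof. by rewrite /vol => /negPf->. Qed.

(** The coefficients of the linear form [u] |-> [vol (u :: z)] in the covectors [g (tnth f i)]:
    cofactors along the first column. *)
Definition vol_minor (z : seq V) (i : 'I_n) : R :=
  if (size z).+1 == n then
    (-1) ^+ i * \det (\matrix_(a < n.-1, b < n.-1)
                       g (tnth f (lift i a)) (nth 0 z b))
  else 0.

Lemma vol_expand s u r :
  vol (s ++ u :: r) =
  (-1) ^+ size s * \sum_i g (tnth f i) u * vol_minor (s ++ r) i.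
Proof.
rewrite /vol /vol_minor !size_cat /= addnS; case: eqP => [en|_]; last first.
  by rewrite big1 ?mulr0 // => i _; rewrite mulr0.
have lt_s : (size s < n)%N by rewrite -en ltnS leq_addr.
rewrite (expand_det_col _ (Ordinal lt_s)) mulr_sumr; apply: eq_bigr => i _.
rewrite mxE /= nth_cat ltnn subnn /= [RHS]mulrCA; congr (_ * _).
rewrite /cofactor exprD mulrA [_ ^+ size s * _]mulrC; congr (_ * \det _).
apply/matrixP => a b; rewrite !mxE /=; congr (g _ _).
(* Deleting the column of [u] shifts the columns of [r] back by one, which leaves those of
   [s ++ r]. *)
rewrite /bump; have [lt_bs|le_sb] := ltnP b (size s).
  by rewrite add0n !nth_cat lt_bs.
by rewrite add1n !nth_cat !ltnNge le_sb leqW // subSn.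
Qed.

Lemma vol_cons u z : vol (u :: z) = \sum_i g (tnth f i) u * vol_minor z i.
Proof. by rewrite -[_ :: z]/([::] ++ _ :: z) vol_expand mul1r. Qed.

Lemma vol_move s u r : vol (s ++ u :: r) = (-1) ^+ size s * vol (u :: s ++ r).
Proof. by rewrite vol_expand vol_cons. Qed.

Lemma vol_not_uniq x : ~~ uniq x -> vol x = 0.
Proof.
rewrite /vol; case: eqP => // sx /(uniqPn 0)[i [j [ltij ltj eij]]].
rewrite sx in ltj; have lti := ltn_trans ltij ltj.
rewrite -det_tr (determinant_alternate (i1 := Ordinal lti) (i2 := Ordinal ltj)) //.
  by rewrite -(inj_eq val_inj) /= (ltn_eqF ltij).
by move=> k; rewrite !mxE /= eij.
Qed.

(** The trace of a product of two linear forms does not depend on the orthonormal basis. This passes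
    from the basis [e] of the contraction to the basis [f] of the star. *)
Lemma vol_contract (e : n.-tuple V) y z :
  orthonormal_basis g f -> orthonormal_basis g e ->
  \sum_(u <- e) vol (u :: y) * vol (u :: z) =
  \sum_i vol (tnth f i :: y) * vol (tnth f i :: z).
Proof.
move=> of_.
suff key (e' : n.-tuple V) : orthonormal_basis g e' ->
    \sum_(u <- e') vol (u :: y) * vol (u :: z) =
    \sum_i vol_minor y i * vol_minor z i.
  by move=> oe; rewrite key // -(key f) // big_tuple.
move=> oe; rewrite big_tuple.
(* By Parseval the inner sum is the Kronecker delta of [i] and [j]. *)
transitivity (\sum_(i < n) \sum_(j < n) (vol_minor y i * vol_minor z j) *
  \sum_(k < n) g (tnth f i) (tnth e' k) * g (tnth f j) (tnth e' k)).
  under [RHS]eq_bigr do under eq_bigr do rewrite mulr_sumr.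
  under [RHS]eq_bigr do rewrite exchange_big.
  rewrite [RHS]exchange_big; apply: eq_bigr => k _ /=.
  rewrite !vol_cons mulr_suml; apply: eq_bigr => i _.
  rewrite mulr_sumr; apply: eq_bigr => j _.
  by rewrite mulrACA mulrC.
apply: eq_bigr => i _; rewrite (bigD1 i) //= orthonormal_parseval //.
rewrite orthonormal_tnth // eqxx mulr1 big1 ?addr0 // => j /negPf ji.
by rewrite orthonormal_parseval // orthonormal_tnth // eq_sym ji mulr0.
Qed.

(** * The double Hodge star, metric multiplication and contraction *)

Lemma dstarE w x y :
  dstar g f w x y =
  \sum_(J : {set 'I_n}) \sum_(K : {set 'I_n})
    vol (x ++ fsub J) * vol (y ++ fsub K) * w (fsub J) (fsub K).
Proof.
have hodge_sum z (G : {set 'I_n} -> R -> R) : (forall J, G J 0 = 0) ->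
    \sum_(J in [set J : {set 'I_n} | (size z + #|J| == n)%N])
      G J (vol (z ++ fsub J)) = \sum_J G J (vol (z ++ fsub J)).
  move=> G0.
  rewrite [RHS](bigID (mem [set J : {set 'I_n} | (size z + #|J| == n)%N])) /=.
  rewrite [X in _ = _ + X]big1 ?addr0 // => J; rewrite inE => nJ.
  by rewrite vol_size ?G0 // size_cat size_map -cardE.
rewrite /dstar /deval big_map big_enum /=.
rewrite (hodge_sum _ (fun J c => \sum_(b <- hodge g f y)
  c * b.1 * w (fsub J) b.2)) => [|J]; last first.
  by rewrite big1 // => b _; rewrite !mul0r.
apply: eq_bigr => J _; rewrite big_map big_enum /=.
rewrite (hodge_sum _ (fun K c => vol (x ++ fsub J) * c * w (fsub J) (fsub K))) //.
by move=> K; rewrite mulr0 mul0r.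
Qed.

(* Reindexing by [J' = t |: J]: moving [f_t] to the front of [f_J'] produces
   exactly the sign carried by the unshuffle. *)
Lemma vol_unshuffle (F : seq V -> seq V -> R) x :
  (forall u v, size u != 1%N -> F u v = 0) ->
  \sum_(J : {set 'I_n}) vol (x ++ fsub J) * unshuffle F (fsub J) =
  (-1) ^+ size x * \sum_(J : {set 'I_n}) \sum_t
     vol (tnth f t :: x ++ fsub J) * F [:: tnth f t] (fsub J).
Proof.
move=> F1.
have rem_fsub (J : {set 'I_n}) t : map (tnth f) (rem t (enum J)) = fsub (J :\ t).
  rewrite /fsub rem_filter ?enum_uniq // -filter_predI; congr map.
  by apply: eq_filter => u; rewrite /= !inE.
transitivity (\sum_(J : {set 'I_n}) \sum_(t in J)
   vol (x ++ tnth f t :: fsub (J :\ t)) * F [:: tnth f t] (fsub (J :\ t))).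
  apply: eq_bigr => J _; rewrite unshuffle_size1 ?enum_uniq // big_enum /=.
  rewrite mulr_sumr; apply: eq_bigr => t tJ.
  rewrite -!rem_fsub mulrA; congr (_ * _).
  have st : enum J = take (index t (enum J)) (enum J) ++
                     t :: drop (index t (enum J)).+1 (enum J).
    rewrite -[LHS](cat_take_drop (index t (enum J))).
    rewrite (drop_nth t) ?index_mem ?mem_enum //.
    by rewrite nth_index ?mem_enum.
  rewrite /fsub {1}st remE !map_cat /= catA !vol_move -!catA.
  rewrite size_cat size_map size_takel ?index_size //.
  by rewrite addnC exprD -mulrA mulrC signrMK.
rewrite (exchange_big_dep xpredT) //= [in RHS]exchange_big mulr_sumr /=.
apply: eq_bigr => t _.
rewrite (reindex_onto (fun J => t |: J) (fun J => J :\ t)) => [|J tJ]; last first.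
  by rewrite setD1K.
rewrite mulr_sumr [RHS](bigID (fun J : {set 'I_n} => t \in J)) /=.
(* If [t] already lies in [J], the volume has a repeated vector, so [t] may range over all
   indices. *)
rewrite [X in _ = X + _]big1.
  rewrite add0r; apply: eq_big => J.
    by rewrite setU11 /=; apply/eqP/idP => [<-|tJ]; rewrite ?setD11 ?setU1K.
  by rewrite setU11 /= => /eqP->; rewrite vol_move mulrA.
move=> J tJ; rewrite vol_not_uniq ?mul0r ?mulr0 //=.
by rewrite mem_cat map_f ?orbT // mem_enum.
Qed.

Lemma contraction_dstar (e : n.-tuple V) w x y :
  orthonormal_basis g e -> orthonormal_basis g f -> balanced w ->
  contraction e (dstar g f w) x y = dstar g f (dmul (dmetric g) w) x y.
Proof.
move=> oe of_ bw.
transitivity (\sum_(J : {set 'I_n}) \sum_t vol (tnth f t :: x ++ fsub J) *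
  \sum_(K : {set 'I_n}) vol (tnth f t :: y ++ fsub K) * w (fsub J) (fsub K)).
  rewrite /contraction; under eq_bigr do rewrite dstarE.
  rewrite exchange_big /=; apply: eq_bigr => J _.
  under [RHS]eq_bigr do rewrite mulr_sumr.
  rewrite exchange_big [RHS]exchange_big /=; apply: eq_bigr => K _.
  rewrite -mulr_suml vol_contract // mulr_suml.
  by apply: eq_bigr => t _; rewrite mulrA.
rewrite dstarE.
(* The unshuffle of the second argument is resolved first, with [x1] and [x2] fixed; that of the
   first argument follows. *)
transitivity (\sum_(J : {set 'I_n}) vol (x ++ fsub J) * unshuffle (fun x1 x2 =>
  (-1) ^+ size y * \sum_(K : {set 'I_n}) \sum_t vol (tnth f t :: y ++ fsub K) *
   (dmetric g x1 [:: tnth f t] * w x2 (fsub K))) (fsub J)); last first.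
  apply: eq_bigr => J _.
  under [RHS]eq_bigr do rewrite -mulrA dmulE -unshuffleZ.
  rewrite -mulr_sumr -unshuffle_sum; congr (_ * _).
  apply: eq_unshuffle => x1 x2 _; rewrite vol_unshuffle //.
  by case: x1 => [|? [|? ?]] [|? [|? ?]] //= *; rewrite mul0r.
rewrite vol_unshuffle => [|u v u1]; last first.
  rewrite big1 ?mulr0 // => K _; rewrite big1 // => t _.
  by rewrite dmetric_balanced ?mul0r ?mulr0.
rewrite mulr_sumr; apply: eq_bigr => J _; rewrite mulr_sumr; apply: eq_bigr => t _.
have [sJ|nJ] := eqVneq (size (tnth f t :: x ++ fsub J)) n; last first.
  by rewrite vol_size // !mul0r mulr0.
rewrite mulrCA; congr (_ * _); rewrite !mulr_sumr; apply: eq_bigr => K _.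
(* The metric factor pairs [f_t] with [f_s], so only the common index [s = t] remains. *)
rewrite (bigD1 t) //= [X in _ + X]big1 => [|s /negPf st]; last first.
  by rewrite orthonormal_tnth // eq_sym st mul0r mulr0.
rewrite orthonormal_tnth // eqxx mul1r addr0 mulrA.
(* In a nonzero term [J] and [K] have equal size and both volumes have [n] arguments. Hence [x] and
   [y] have equal length and their signs cancel. *)
have [eJK|/bw->] := eqVneq (size (fsub J)) (size (fsub K)); last first.
  by rewrite !mulr0.
have [sK|nK] := eqVneq (size (tnth f t :: y ++ fsub K)) n; last first.
  by rewrite vol_size // mul0r mulr0.
have exy : size x = size y.
  have := etrans sJ (esym sK); rewrite /= !size_cat eJK => -[]; exact: addIn.
by rewrite exy -mulrA signrMK.
Qed.

Lemma dstar_dscale a w x y :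
  dstar g f (dscale a w) x y = a * dstar g f w x y.
Proof.
rewrite /dstar /deval mulr_sumr; apply: eq_bigr => u _.
by rewrite mulr_sumr; apply: eq_bigr => v _; rewrite /dscale mulrCA.
Qed.

Lemma eq_dstar w w' : w =2 w' -> dstar g f w =2 dstar g f w'.
Proof.
by move=> e x y; apply: eq_bigr => u _; apply: eq_bigr => v _; rewrite e.
Qed.

(** Contraction contributes one more factor [g], and the scalar comes from 1/m! = (m+1)/(m+1)!. *)
Lemma contraction_star_metric_power (e : n.-tuple V) w m x y :
  orthonormal_basis g e -> orthonormal_basis g f -> balanced w ->
  contraction e (dstar g f
    (dscale (m`!)%:R^-1 (dmul (dexp (dmetric g) m) w))) x y =
  dscale m.+1%:R (dstar g f
    (dscale (m.+1`!)%:R^-1 (dmul (dexp (dmetric g) m.+1) w))) x y.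
Proof.
move=> oe of_ bw; rewrite /contraction.
under eq_bigr do rewrite dstar_dscale.
rewrite -mulr_sumr -/(contraction e _ x y) contraction_dstar //; last first.
  apply: dmul_balanced bw; apply: dexp_balanced; exact: dmetric_balanced.
rewrite /dscale -/(dscale _ _) dstar_dscale mulrA factS natrM invfM mulrA.
rewrite divff ?pnatr_eq0 // mul1r; congr (_ * _).
by apply: eq_dstar => u v; rewrite dmulA.
Qed.

End Star.

(** * The two contraction identities *)

Theorem theorem3p4 (R : realType) (V : vectType R) (n : nat)
    (dimV : \dim {:V} = n) (g : {dot V for idfun})
    (e : n.-tuple V) (e_onb : orthonormal_basis g e)
    (f : n.-tuple V) (f_onb : orthonormal_basis g f)
    (Rm : dform V) (Rm_dform : is_dform 2 2 Rm)
    (Rm_sym : dsymmetric Rm) (Rm_bianchi : bianchi Rm) (k : nat) :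
  ((2 <= 2 * k <= n - 2)%N ->
     forall x y : seq V,
       contraction e (N2k g f Rm k) x y
       = dscale (n - 2 * k - 1)%:R (T2k g f Rm k) x y)
  /\
  ((2 <= 2 * k <= n - 1)%N ->
     forall x y : seq V,
       contraction e (T2k g f Rm k) x y
       = dscale (n - 2 * k)%:R (h2k g f Rm k) x y).
Proof.
have bR : balanced (dexp Rm k) by apply/dexp_balanced/dform_balanced/Rm_dform.
split=> /andP[k2 kn] x y; rewrite /N2k /T2k /h2k.
(* The bounds on [k] keep the truncated subtractions genuine: here the metric powers in [N2k] and
   [T2k] are [m] and [m.+1]. In the second case those in [T2k] and [h2k] are. *)
- have [m ->] : exists m, (n - 2 * k = m.+2)%N by exists (n - 2 * k - 2)%N; lia.
  by rewrite !subSS !subn0; apply: contraction_star_metric_power.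
- have [m ->] : exists m, (n - 2 * k = m.+1)%N by exists (n - 2 * k - 1)%N; lia.
  by rewrite !subSS !subn0; apply: contraction_star_metric_power.
Qed.
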